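(* Let $M>0$ and let $K\subset\mathbb{R}^n\times\widetilde{G}^n_d$ be a compact subset. If $k$ is $C_0$-universal, then $d_{W^*}$ metrizes the weak-* convergence of varifolds on $\mathcal{V}_{d,M,K}=\{\mu\in\mathcal{V}_d : |\mu|(\mathbb{R}^n)\le M,\ \mathrm{supp}(\mu)\subset K\}$.
   Context: Let $0\le d\le n$. $\widetilde{G}^n_d$ is the set of oriented $d$-dimensional linear subspaces of $\mathbb{R}^n$, identified with a subset of the unit sphere of $\Lambda^d(\mathbb{R}^n)$ by $T\mapsto \frac{u_1\wedge\cdots\wedge u_d}{|u_1\wedge\cdots\wedge u_d|}$ for any basis $(u_i)$ of $T$ consistent with its orientation (inner product $\langle \xi_1\wedge\cdots\wedge\xi_d,\eta_1\wedge\cdots\wedge\eta_d\rangle=\det(\xi_i\cdot\eta_j)_{i,j}$), with the induced topology. $\mathcal{V}_d$ is the set of oriented $d$-varifolds, i.e. nonnegative finite Radon measures on $\mathbb{R}^n\times\widetilde{G}^n_d$; $|\mu|(A)=\mu(A\times\widetilde{G}^n_d)$ for Borel $A\subset\mathbb{R}^n$; $(\mu|\omega)=\int\omega\,d\mu$. Weak-* convergence $\mu_i\to\mu$ means $(\mu_i|\omega)\to(\mu|\omega)$ for all continuous compactly supported $\omega$ on $\mathbb{R}^n\times\widetilde{G}^n_d$. Standing assumptions on kernels: $k^{pos}$ and $k^G$ are continuous positive definite kernels on $\mathbb{R}^n$ and $\widetilde{G}^n_d$ respectively, with $k^{pos}(x,\cdot)\in C_0(\mathbb{R}^n)$ for every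 $x$ ($C_0$: continuous functions vanishing at infinity). $W$ is the reproducing kernel Hilbert space (RKHS) of $k((x,T),(x',T'))=k^{pos}(x,x')k^G(T,T')$; it is continuously embedded in $C_0(\mathbb{R}^n\times\widetilde{G}^n_d)$. $d_{W^*}(\mu,\mu')=\|\mu-\mu'\|_{W^*}$ where $\|\mu\|_{W^*}=\sup_{\omega\in W,\|\omega\|_W\le1}|(\mu|\omega)|$. The kernel $k$ is $C_0$-universal if $W$ is dense in $C_0(\mathbb{R}^n\times\widetilde{G}^n_d)$ for uniform convergence. *)

(* Defs.v *)
From HB Require Import structures.
From mathcomp Require Import all_boot all_order all_algebra.
From mathcomp Require Import all_classical all_reals all_analysis.
Import Order.TTheory GRing.Theory Num.Theory.
Import numFieldNormedType.Exports.

Set Implicit Arguments.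
Unset Strict Implicit.
Unset Printing Implicit Defensive.

Local Open Scope classical_set_scope.
Local Open Scope ring_scope.

(** * The oriented Grassmannian *)

(** A vector of [Lambda^d(R^n)] is given by its coordinates in the basis
    [e_(i_1) /\ ... /\ e_(i_d)], [i_1 < ... < i_d]; this type lists these
    strictly increasing multi-indices. *)
Definition multi_index (n d : nat) : finType :=
  {t : d.-tuple 'I_n | sorted ltn (map val t)}.

Definition dvector (R : realType) (n d : nat) := 'rV[R]_#|multi_index n d|.

(** [u_1 /\ ... /\ u_d], where [u_i] is the [i]-th row of [u]: its coordinates
    are the maximal minors of [u]. *)
Definition wedge (R : realType) (n d : nat) (u : 'M[R]_(d, n)) : dvector R n d :=
  \row_k \det (colsub (tnth (val (enum_val k))) u).

(** The norm of [u_1 /\ ... /\ u_d] for the inner product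
    [<xi_1 /\ ... /\ xi_d, eta_1 /\ ... /\ eta_d> = det (xi_i . eta_j)]. *)
Definition wedge_norm (R : realType) (n d : nat) (u : 'M[R]_(d, n)) : R :=
  Num.sqrt (\det (u *m u^T)).

Definition unit_wedge (R : realType) (n d : nat) (u : 'M[R]_(d, n)) :
    dvector R n d :=
  (wedge_norm u)^-1 *: wedge u.

(** [unit_wedge] only depends on the oriented subspace spanned by the basis. *)
Lemma unit_wedge_basis (R : realType) (n d : nat) (A : 'M[R]_d)
    (u : 'M[R]_(d, n)) :
  0 < \det A -> unit_wedge (A *m u) = unit_wedge u.
Proof.
move=> A_gt0; rewrite /unit_wedge /wedge_norm.
have -> : wedge (A *m u) = \det A *: wedge u.
  apply/rowP => k; rewrite !mxE -det_mulmx; congr (\det _).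
  by apply/matrixP => i j; rewrite !mxE; apply: eq_bigr => l _; rewrite !mxE.
rewrite trmx_mul mulmxA -(mulmxA A) det_mulmx det_tr det_mulmx.
rewrite mulrAC -expr2 sqrtrM ?sqr_ge0// sqrtr_sqr gtr0_norm//.
by rewrite scalerA invfM mulrAC mulVf ?mul1r// gt_eqF.
Qed.

Definition ograss_set (R : realType) (n d : nat) : set (dvector R n d) :=
  [set xi | exists2 u : 'M[R]_(d, n), row_free u & xi = unit_wedge u].

(** Here [hd] only serves to make the type inhabited. *)
Definition ograss (R : realType) (n d : nat) (hd : (d <= n)%N) : Type :=
  set_type (@ograss_set R n d).

Lemma ograss_inhabited (R : realType) (n d : nat) (hd : (d <= n)%N) :
  unit_wedge (pid_mx d : 'M[R]_(d, n)) \in @ograss_set R n d.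
Proof.
apply/mem_set; exists (pid_mx d) => //.
by rewrite /row_free rank_pid_mx.
Qed.

(** [R^n * G~^n_d] *)
Definition vspc (R : realType) (n d : nat) (hd : (d <= n)%N) : Type :=
  ('rV[R]_n * ograss R hd)%type.

Section instances.
Variables (R : realType) (n d : nat) (hd : (d <= n)%N).

HB.instance Definition _ :=
  PseudoMetric.copy (ograss R hd) (set_type (@ograss_set R n d)).
HB.instance Definition _ :=
  isPointed.Build (ograss R hd)
    (@exist _ (fun xi => xi \in @ograss_set R n d) _ (ograss_inhabited R hd)).

HB.instance Definition _ :=
  PseudoMetric.copy (vspc R hd) ('rV[R]_n * ograss R hd)%type.
HB.instance Definition _ :=
  Pointed.copy (vspc R hd) ('rV[R]_n * ograss R hd)%type.

End instances.

(** * Function spaces *)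

Section function_spaces.
Variables (R : realType) (T : topologicalType).

Definition C0 : set (T -> R) :=
  [set f | continuous f /\
           forall e : R, 0 < e -> compact [set x | e <= `|f x|]].

Definition Cc : set (T -> R) :=
  [set f | continuous f /\ compact (closure [set x | f x != 0])].

End function_spaces.

(** * Kernels and reproducing kernel Hilbert spaces *)

Section rkhs.
Variable R : realType.

Definition positive_definite (T : Type) (k : T -> T -> R) : Prop :=
  (forall x y, k x y = k y x) /\
  (forall (m : nat) (x : 'I_m -> T) (c : 'I_m -> R),
     0 <= \sum_i \sum_j c i * c j * k (x i) (x j)).

Definition prod_kernel (S T : Type) (kS : S -> S -> R) (kT : T -> T -> R) :
    S * T -> S * T -> R :=
  fun p q => kS p.1 q.1 * kT p.2 q.2.

Section function_hilbert_space.
Variables (T : Type) (W : set (T -> R)) (ip : (T -> R) -> (T -> R) -> R).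

Definition hnorm (f : T -> R) : R := Num.sqrt (ip f f).

(** The values of [ip] outside [W] are irrelevant. *)
Record is_function_hilbert_space : Prop := {
  fhs_zero : W (cst 0) ;
  fhs_linear : forall (a : R) f g, W f -> W g -> W (a *: f + g) ;
  fhs_ipC : forall f g, W f -> W g -> ip f g = ip g f ;
  fhs_ip_linear : forall (a : R) f g h, W f -> W g -> W h ->
    ip (a *: f + g) h = a * ip f h + ip g h ;
  fhs_ip_ge0 : forall f, W f -> 0 <= ip f f ;
  fhs_ip_eq0 : forall f, W f -> ip f f = 0 -> f = cst 0 ;
  fhs_complete : forall u : nat -> T -> R, (forall i, W (u i)) ->
    (forall e : R, 0 < e -> \forall i & j \near \oo, hnorm (u i - u j) < e) ->
    exists2 f, W f & hnorm (u i - f) @[i --> \oo] --> (0 : R) }.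

Record is_rkhs (k : T -> T -> R) : Prop := {
  rkhs_hilbert : is_function_hilbert_space ;
  rkhs_kernel : forall z, W (k z) ;
  rkhs_reproducing : forall f z, W f -> ip f (k z) = f z }.

Definition dual_norm (l : (T -> R) -> R) : \bar R :=
  ereal_sup [set (`|l w|)%:E | w in [set w | W w /\ hnorm w <= 1]].

End function_hilbert_space.

Definition embeds_in_C0 (T : topologicalType) (W : set (T -> R))
    (ip : (T -> R) -> (T -> R) -> R) : Prop :=
  W `<=` @C0 R T /\
  exists c : R, forall f, W f -> forall z, `|f z| <= c * hnorm ip f.

(** With [W] the RKHS of [k], this is the [C0]-universality of [k]. *)
Definition C0_universal (T : topologicalType) (W : set (T -> R)) : Prop :=
  W `<=` @C0 R T /\
  forall f, @C0 R T f -> forall e : R, 0 < e ->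
    exists2 w, W w & forall z, `|w z - f z| <= e.

End rkhs.

(** * Varifolds *)

Definition borel (T : ptopologicalType) := g_sigma_algebraType (@open T).

Definition inner_regular (R : realType) (T : ptopologicalType)
    (mu : set (borel T) -> \bar R) : Prop :=
  forall A : set (borel T), measurable A ->
    mu A = ereal_sup [set mu C | C in
      [set C : set (borel T) |
       [/\ measurable C, compact (C : set T) & C `<=` A]]].

(** Finiteness on compact sets, the other condition on Radon measures, is
    automatic for a finite measure. *)
Record varifold (R : realType) (n d : nat) (hd : (d <= n)%N) := Varifold {
  vmeas :> {finite_measure set (borel (vspc R hd)) -> \bar R} ;
  vmeas_radon : inner_regular vmeas }.

Section varifolds.
Variables (R : realType) (n d : nat) (hd : (d <= n)%N).
Local Notation X := (vspc R hd).
Local Notation V := (varifold R hd).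
Implicit Types mu nu : V.

(** As functions on [set X], measures may differ on non-measurable sets. *)
Definition vequal mu nu : Prop :=
  forall A : set (borel X), measurable A -> mu A = nu A.

Definition weight mu (A : set 'rV[R]_n) : \bar R :=
  mu (A `*` [set: ograss R hd]).

Definition support mu : set X :=
  [set z | forall U : set X, open U -> U z -> (0 < mu U)%E].

Definition pairing mu (w : X -> R) : R := \int[mu]_z w z.

Definition weak_star_cvg (I : Type) (F : set_system I) (mu_ : I -> V) mu :
    Prop :=
  forall w : X -> R, @Cc R X w -> pairing (mu_ i) w @[i --> F] --> pairing mu w.

Definition dWstar (W : set (X -> R)) (ip : (X -> R) -> (X -> R) -> R) mu nu :
    \bar R :=
  dual_norm W ip (fun w => pairing mu w - pairing nu w).

(** [V_(d,M,K)] *)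
Definition varifolds_in (M : R) (K : set X) : set V :=
  [set mu | (weight mu setT <= M%:E)%E /\ support mu `<=` K].

Record is_metric_on (D : set V) (dist : V -> V -> \bar R) : Prop := {
  metric_fin_num : forall mu nu, D mu -> D nu -> dist mu nu \is a fin_num ;
  metric_eq0 : forall mu nu, D mu -> D nu ->
    (dist mu nu = 0%E <-> vequal mu nu) ;
  metric_sym : forall mu nu, D mu -> D nu -> dist mu nu = dist nu mu ;
  metric_triangle : forall mu nu xi, D mu -> D nu -> D xi ->
    (dist mu xi <= dist mu nu + dist nu xi)%E }.

(** Convergence of [mu_ i] is taken along an arbitrary proper filter [F] on the
    indices, so that sequences ([F := \oo]) and nets are both covered. *)
Definition metrizes_weak_star_on (D : set V) (dist : V -> V -> \bar R) : Prop :=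
  is_metric_on D dist /\
  forall (I : Type) (F : set_system I), ProperFilter F ->
  forall (mu_ : I -> V) (mu : V), (forall i, D (mu_ i)) -> D mu ->
    (weak_star_cvg F mu_ mu <-> dist (mu_ i) mu @[i --> F] --> 0%E).

End varifolds.

(* Main.v *)
Require Import Defs.
From HB Require Import structures.
From mathcomp Require Import all_boot all_order all_algebra.
From mathcomp Require Import all_classical all_reals all_analysis.
From mathcomp Require Import finmap measurable_realfun ring lra.
Import Order.TTheory GRing.Theory Num.Theory.
Import numFieldNormedType.Exports.

(** All measures involved are concentrated on the compact set K and have mass at
    most M.  By the reproducing property and Cauchy-Schwarz, every w in the unit
    ball of W satisfies
      (w x - w z)^2 <= k(z,z) + k(x,x) - 2 k(z,x),
    so the unit ball is equicontinuous.  A partition of unity (phi_j) of K by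
    functions in Cc, subordinate to small balls for this kernel distance, gives
    |(mu|w) - sum_j w(z_j) (mu|phi_j)| <= e M uniformly in w and mu: the
    convergence of the finitely many (mu_i|phi_j) forces d_{W*} -> 0.
    Conversely, universality approximates each f in Cc by some w in W, and
    |(mu|w) - (nu|w)| <= d_{W*}(mu, nu) (|w|_W + 1).  The space has enough
    compactly supported functions because the Grassmannian is compact: by
    Gram-Schmidt it is the image of the orthonormal frames under the wedge. *)

Set Implicit Arguments.
Unset Strict Implicit.
Unset Printing Implicit Defensive.

Local Open Scope classical_set_scope.
Local Open Scope ring_scope.

(** * The oriented Grassmannian *)

(** Induction on the number of rows: the lower rows are orthonormalised first, then the top row is
    made orthogonal to them and normalised. The change of basis is block upper triangular, so its
    determinant is a product of positive factors; positivity is what preserves the orientation. *)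
Lemma gram_schmidt (F : rcfType) (d n : nat) (u : 'M[F]_(d, n)) :
  row_free u ->
  exists2 A : 'M[F]_d, 0 < \det A & (A *m u) *m (A *m u)^T = 1%:M.
Proof.
elim: d u => [|d IH]; last rewrite -[d.+1]/(1 + d)%N => u ufree.
  by move=> u _; exists 1%:M; [rewrite det1 | apply/matrixP => -[]].
pose v := usubmx u; pose w := dsubmx u.
have uE : u = col_mx v w by rewrite vsubmxK.
have wfree : row_free w.
  apply: inj_row_free => x xw0.
  have /eqP : @row_mx F 1 1 d 0 x *m u = 0.
    by rewrite uE mul_row_col mul0mx xw0 addr0.
  rewrite (mulmx_free_eq0 _ ufree) => /eqP /(congr1 (@rsubmx F 1 1 d)).
  by rewrite row_mxKr linear0.
have [A' A'_gt0 w1E] := IH w wfree.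
have [w1 w1def] : exists w1, w1 = A' *m w by exists (A' *m w).
rewrite -w1def in w1E.
pose v' := v - v *m w1^T *m w1.
(* As a combination of the rows of [u], [v'] has leading coefficient 1, so freeness of [u] makes it
   nonzero. *)
have v'E : v' = @row_mx F 1 1 d 1%:M (- (v *m w1^T *m A')) *m u.
  by rewrite uE mul_row_col mul1mx mulNmx /v' w1def !mulmxA.
have v'_neq0 : v' != 0.
  rewrite v'E (mulmx_free_eq0 _ ufree).
  apply/eqP => /(congr1 (@lsubmx F 1 1 d)); rewrite row_mxKl linear0.
  by move=> /matrixP /(_ 0 0); rewrite !mxE eqxx => /eqP; rewrite oner_eq0.
pose q := (v' *m v'^T) 0 0.
have qE : v' *m v'^T = q%:M by rewrite [LHS]mx11_scalar.
have q_gt0 : 0 < q.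
  have qsum : q = \sum_j v' 0 j ^+ 2.
    by rewrite /q mxE; apply: eq_bigr => j _; rewrite [X in _ * X]mxE -expr2.
  have qge0 j : true -> 0 <= v' 0 j ^+ 2 by rewrite sqr_ge0.
  rewrite lt_def qsum sumr_ge0 ?andbT//.
  apply: contra v'_neq0; rewrite psumr_eq0//.
  move=> /allP v0; apply/eqP/rowP => j; rewrite [RHS]mxE.
  by have /= := v0 j (mem_index_enum _); rewrite sqrf_eq0 => /eqP.
have v'w1 : v' *m w1^T = 0.
  by rewrite /v' mulmxBl -!mulmxA w1E mulmx1 subrr.
pose c := (Num.sqrt q)^-1.
have c_gt0 : 0 < c by rewrite invr_gt0 sqrtr_gt0.
have ccq : c * c * q = 1.
  by rewrite -expr2 exprVn sqr_sqrtr ?ltW// mulVf// gt_eqF.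
exists (@block_mx F 1 d 1 d c%:M (- (c *: (v *m w1^T *m A'))) 0 A').
  by rewrite [X in 0 < X](det_ublock c%:M _ A') det_scalar expr1 mulr_gt0.
rewrite uE mul_block_col mul0mx add0r.
have -> : c%:M *m v + - (c *: (v *m w1^T *m A')) *m w = c *: v'.
  by rewrite mul_scalar_mx mulNmx -scalemxAl -scalerBr /v' w1def !mulmxA.
rewrite -w1def tr_col_mx mul_col_row !linearZ/= -!scalemxAl qE v'w1 w1E.
have -> : w1 *m v'^T = 0 by rewrite -[LHS]trmxK trmx_mul trmxK v'w1 linear0.
by rewrite !scaler0 scalerA scale_scalar_mx ccq -scalar_mx_block.
Qed.

(** * Continuity of polynomial expressions in matrix entries *)

Section continuity_in_matrices.
Variables (R : realType) (T : topologicalType).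

Lemma continuous_matrix (m n : nat) (f : T -> 'M[R]_(m, n)) :
  (forall i j, continuous (fun x => f x i j)) -> continuous f.
Proof.
move=> fc x A [P Px PA].
have : \forall y \near x, forall i j, P i j (f y i j).
  do 2 apply: filter_forall => ?; exact: fc.
by apply: filterS => y Py; exact: PA.
Qed.

Lemma continuous_sum (I : Type) (r : seq I) (P : pred I) (F : I -> T -> R) :
  (forall i, P i -> continuous (F i)) ->
  continuous (fun x => \sum_(i <- r | P i) F i x).
Proof.
apply: continuous_big => x.
by apply: cvgD; [exact: cvg_fst | exact: cvg_snd].
Qed.

Lemma continuous_mulmx (m n p : nat) (f : T -> 'M[R]_(m, n))
    (g : T -> 'M[R]_(n, p)) :
  (forall i j, continuous (fun x => f x i j)) ->
  (forall i j, continuous (fun x => g x i j)) ->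
  forall i j, continuous (fun x => (f x *m g x) i j).
Proof.
move=> fc gc i j.
under eq_fun do rewrite mxE.
apply: continuous_sum => k _ x.
by apply: cvgM; [exact: fc | exact: gc].
Qed.

Lemma continuous_det (n : nat) (f : T -> 'M[R]_n) :
  (forall i j, continuous (fun x => f x i j)) ->
  continuous (fun x => \det (f x)).
Proof.
move=> fc; rewrite /determinant.
apply: continuous_sum => s _ x.
apply: cvgMl_tmp.
by apply: continuous_big => [|k _]; [exact: mul_continuous | exact: fc].
Qed.

End continuity_in_matrices.

(** * Compactness and separation of the Grassmannian *)

Section grassmannian_topology.
Variables (R : realType).

Lemma hausdorff_injective (S T : topologicalType) (f : S -> T) :
  continuous f -> injective f -> hausdorff_space T -> hausdorff_space S.
Proof.
move=> fc finj hT p q pq; apply: finj; apply: hT => A B /fc Ap /fc Bq.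
by have [x [Ax Bx]] := pq _ _ Ap Bq; exists (f x).
Qed.

Lemma hausdorff_prod (S T : topologicalType) :
  hausdorff_space S -> hausdorff_space T -> hausdorff_space (S * T)%type.
Proof.
move=> hS hT [s t] [s' t'] st; congr pair.
- apply: hS => A B As Bs'.
  have [||[x y] [/= Ax Bx]] := st (A `*` setT) (B `*` setT).
  + by exists (A, setT) => //; split=> //; exact: filterT.
  + by exists (B, setT) => //; split=> //; exact: filterT.
  by exists x; split; [case: Ax | case: Bx].
- apply: hT => A B At Bt'.
  have [||[x y] [/= Ay By]] := st (setT `*` A) (setT `*` B).
  + by exists (setT, A) => //; split=> //; exact: filterT.
  + by exists (setT, B) => //; split=> //; exact: filterT.
  by exists y; split; [case: Ay | case: By].
Qed.

(** The image filter under [set_val] contains [A], hence clusters at a point of [A]. Open sets of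
    the subtype are preimages of open sets, so that cluster point lifts. *)
Lemma compact_set_type (T : topologicalType) (A : set T) :
  compact A -> compact [set: set_type A].
Proof.
move=> cA F FF _.
have FA : F (set_val @^-1` A).
  by apply: filterE => x; exact: set_valP.
have [p [Ap clp]] := cA (set_val @ F) _ FA.
exists (exist _ p (mem_set Ap)); split=> // B C FB [_ [[D oD <-] Dp DC]].
have FB' : F (set_val @^-1` (set_val @` B)).
  by apply: filterS FB => x Bx; exists x.
have [_ [[x Bx <-] Dx]] := clp _ _ FB' (open_nbhs_nbhs (conj oD Dp)).
by exists x; split=> //; exact: DC.
Qed.

Lemma compact_ograss_set (n d : nat) : compact (@ograss_set R n d).
Proof.
(* Frames are flattened to row vectors, for which Heine-Borel is available. *)
pose S := [set v : 'rV[R]_(d * n) | vec_mx v *m (vec_mx v)^T = 1%:M].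
have vecc i j : continuous (fun v : 'rV[R]_(d * n) => vec_mx v i j).
  by under eq_fun do rewrite mxE; exact: coord_continuous.
have Sc : compact S.
  apply: bounded_closed_compact.
    exists 1; split=> // b b1 v Sv /=.
    rewrite [leLHS]mx_normrE; apply/bigmax_leP; split; first lra.
    move=> [i k] _ /=; rewrite (ord1 i) {i}; apply: le_trans (ltW b1).
    have [i j] := mxvec_indexP k.
    (* The square of each entry is one term of a diagonal entry of the Gram matrix, which bounds it
       by 1. *)
    have : (vec_mx v *m (vec_mx v)^T) i i = 1 by rewrite Sv mxE eqxx.
    rewrite mxE (bigD1 j)//= !mxE -expr2 => vij.
    rewrite -(@ler_pXn2r _ 2) ?nnegrE// expr1n real_normK ?num_real// -vij lerDl.
    by apply: sumr_ge0 => l _; rewrite !mxE -expr2 sqr_ge0.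
  have -> : S = (fun v => vec_mx v *m (vec_mx v)^T) @^-1` [set 1%:M] by [].
  apply: closed_comp; last first.
    by apply: compact_closed; [exact: norm_hausdorff | exact: compact_set1].
  move=> v _; apply: continuous_matrix; apply: continuous_mulmx => // i j.
  by under eq_fun do rewrite [_^T _ _]mxE; exact: vecc.
(* On orthonormal frames the Gram determinant is 1, so the normalising factor disappears and the
   parametrisation becomes polynomial. *)
have -> : @ograss_set R n d = (fun v => wedge (vec_mx v)) @` S.
  have unit_wedgeS (u : 'M[R]_(d, n)) : u *m u^T = 1%:M -> unit_wedge u = wedge u.
    by move=> uu; rewrite /unit_wedge /wedge_norm uu det1 sqrtr1 invr1 scale1r.
  apply/seteqP; split=> [_ [u ufree ->]|_ [v Sv <-]].
    have [A A_gt0 Au] := gram_schmidt ufree.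
    exists (mxvec (A *m u)); rewrite /S/= mxvecK //.
    by rewrite -unit_wedgeS// unit_wedge_basis.
  exists (vec_mx v); last by rewrite unit_wedgeS.
  by apply/row_freeP; exists (vec_mx v)^T.
apply: continuous_compact Sc; apply: continuous_subspaceT.
apply: continuous_matrix => i j.
under eq_fun do rewrite mxE.
by apply: continuous_det => k l; under eq_fun do rewrite mxE; exact: vecc.
Qed.

Variables (n d : nat) (hd : (d <= n)%N).

Lemma compact_ograss : compact [set: ograss R hd].
Proof. exact/compact_set_type/compact_ograss_set. Qed.

Lemma hausdorff_vspc : hausdorff_space (vspc R hd).
Proof.
apply: hausdorff_prod; first exact: norm_hausdorff.
apply: (@hausdorff_injective _ _ (set_val : ograss R hd -> dvector R n d)).
- exact: initial_continuous.
- by move=> [s ps] [t pt] /= st; exact/eq_exist.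
- exact: norm_hausdorff.
Qed.

End grassmannian_topology.

(** * Integration of bounded continuous functions *)

Section continuous_functions.
Variables (R : realType) (T : ptopologicalType).
Hypothesis hT : hausdorff_space T.
Implicit Types f : T -> R.

Lemma Cc_vanishing_outside (S : set T) f : compact S -> continuous f ->
  (forall x, f x != 0 -> S x) -> Cc f.
Proof.
move=> cS fc fS; split=> //; apply: (subclosed_compact _ cS).
  exact: closed_closure.
by rewrite closureE; apply: smallest_sub; [exact: compact_closed | exact: fS].
Qed.

Lemma Cc_C0 f : Cc f -> C0 f.
Proof.
move=> [fc fS]; split=> // e e_gt0; apply: (subclosed_compact _ fS).
  apply: (@closed_comp _ _ (fun x => `|f x|) [set r | e <= r]).
    by move=> x _; apply: cvg_norm; exact: fc.
  exact: closed_ge.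
move=> x /= efx; apply: subset_closure => /=.
by rewrite -normr_gt0 (lt_le_trans e_gt0).
Qed.

Definition bounded_continuous f : Prop :=
  continuous f /\ exists c : R, forall x, `|f x| <= c.

Lemma C0_bounded_continuous f : C0 f -> bounded_continuous f.
Proof.
move=> [fc fK]; split=> //.
(* Off this compact set [f] is bounded by 1. *)
have : compact (f @` [set x | 1 <= `|f x|]).
  by apply: continuous_compact; [exact: continuous_subspaceT | exact: fK].
move=> /compact_bounded [c [_ fc1]].
exists (Num.max 1 (c + 1)) => x; rewrite le_max.
have [//|lt1] := leP `|f x| 1 => /=.
by apply: fc1; [lra | exists x => //=; exact: ltW].
Qed.

Lemma bounded_continuousD f g : bounded_continuous f -> bounded_continuous g ->
  bounded_continuous (fun x => f x + g x).
Proof.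
move=> [fc [a fa]] [gc [b gb]]; split.
  by move=> x; apply: cvgD; [exact: fc | exact: gc].
by exists (a + b) => x; rewrite (le_trans (ler_normD _ _))// lerD.
Qed.

Lemma bounded_continuousZ (a : R) f : bounded_continuous f ->
  bounded_continuous (fun x => a * f x).
Proof.
move=> [fc [c fle]]; split; first by move=> x; apply: cvgMl_tmp; exact: fc.
by exists (`|a| * c) => x; rewrite normrM ler_wpM2l.
Qed.

Lemma bounded_continuousB f g : bounded_continuous f -> bounded_continuous g ->
  bounded_continuous (fun x => f x - g x).
Proof.
move=> bf bg; have := bounded_continuousD bf (bounded_continuousZ (-1) bg).
by under eq_fun do rewrite mulN1r.
Qed.

Lemma bounded_continuous_sum (I : Type) (s : seq I) (f : I -> T -> R) :
  (forall i, bounded_continuous (f i)) ->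
  bounded_continuous (fun x => \sum_(i <- s) f i x).
Proof.
move=> bf; elim: s => [|i s IH].
  under eq_fun do rewrite big_nil.
  by split; [move=> x; exact: cvg_cst | exists 0 => x; rewrite normr0].
under eq_fun do rewrite big_cons.
exact: bounded_continuousD.
Qed.

End continuous_functions.

Section integration.
Variables (R : realType) (T : ptopologicalType).
Hypothesis hT : hausdorff_space T.
Variable mu : {finite_measure set (borel T) -> \bar R}.
Implicit Types f g : T -> R.

Lemma measurable_open (U : set T) : open U -> measurable (U : set (borel T)).
Proof. by move=> oU; apply: sub_sigma_algebra. Qed.

Lemma measurable_closed (F : set T) :
  closed F -> measurable (F : set (borel T)).
Proof.
by move=> /closed_openC /measurable_open /measurableC; rewrite setCK.
Qed.

Lemma measurable_compact (K : set T) :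
  compact K -> measurable (K : set (borel T)).
Proof. by move=> cK; apply: measurable_closed; exact: compact_closed. Qed.

Lemma continuous_measurable f :
  continuous f -> measurable_fun setT (f : borel T -> R).
Proof.
move=> /continuousP fo _ Y mY.
suff : measurable_fun setT (f : borel T -> R) by apply.
apply: (measurability _ (RGenOpens.measurableE R)) => _ [_ [a [b ->]] <-].
by rewrite setTI; apply: measurable_open; apply: fo; exact: interval_open.
Qed.

Lemma bounded_continuous_integrable f : bounded_continuous f ->
  mu.-integrable setT (EFin \o (f : borel T -> R)).
Proof.
move=> [fc [c fle]]; apply: measurable_bounded_integrable => //.
- by rewrite ltey_eq fin_num_measure.
- exact: continuous_measurable.
- exists c; split; first exact: num_real.
  by move=> b cb x _ /=; apply: le_trans (ltW cb).
Qed.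

Lemma Rintegral_sum (I : Type) (s : seq I) (f : I -> T -> R) :
  (forall i, bounded_continuous (f i)) ->
  \int[mu]_x (\sum_(i <- s) f i x) = \sum_(i <- s) \int[mu]_x f i x.
Proof.
move=> bf; elim: s => [|i s IH].
  by under eq_Rintegral do rewrite big_nil; rewrite big_nil Rintegral_cst// mul0r.
under eq_Rintegral do rewrite big_cons.
rewrite big_cons -IH RintegralD//; apply: bounded_continuous_integrable => //.
exact: bounded_continuous_sum.
Qed.

(** The complement of [K] is null, so the bound [c] holds almost everywhere. All later estimates on
    pairings thus involve values on [K] only. *)
Lemma le_Rintegral_concentrated (K : set T) (M c : R) f :
  compact K -> mu (~` K) = 0%E -> (mu setT <= M%:E)%E -> 0 <= c ->
  bounded_continuous f -> (forall x, K x -> `|f x| <= c) ->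
  `|\int[mu]_x f x| <= c * M.
Proof.
move=> cK muK muM c_ge0 bf fle; have int_f := bounded_continuous_integrable bf.
rewrite -lee_fin EFin_normr_Rintegral//.
apply: (le_trans (le_abse_integral _ _ (measurable_int _ int_f))) => //.
apply: (@le_trans _ _ (c%:E * mu setT)%E); last by rewrite EFinM lee_wpmul2l.
apply: integral_le_bound => //; first exact: measurable_int int_f.
exists (~` K); split => //; first by apply: measurableC; exact: measurable_compact.
by move=> x /=; apply: contra_not => Kx _; rewrite lee_fin fle.
Qed.

Hypothesis mu_radon : inner_regular mu.

(** By inner regularity it suffices to treat compact sets [C] disjoint from [K]. Each point of [C]
    has a null open neighbourhood, and finitely many of them cover [C]. *)
Lemma measure0_outside_support (K : set T) : closed K ->
  (forall z, (forall U, open U -> U z -> (0 < mu U)%E) -> K z) ->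
  mu (~` K) = 0%E.
Proof.
move=> cK suppK; have mK := measurableC (measurable_closed cK).
rewrite (mu_radon mK); apply/eqP; rewrite eq_le; apply/andP; split; last first.
  apply: ereal_sup_ubound; exists set0; rewrite ?measure0//.
  by split; [exact: measurable0 | exact: compact0 |].
apply: ge_ereal_sup => _ [C [mC cC CK] <-].
(* With the implication under the existential, a [U] exists for every [z], as [choice] requires. *)
have nbhs0 z : exists U : set T, ~ K z -> [/\ open U, U z & mu U = 0%E].
  have [Kz|nKz] := pselect (K z); first by exists set0.
  have /existsNP[U /not_implyP[oU /not_implyP[Uz /negP]]] :
      ~ forall U, open U -> U z -> (0 < mu U)%E.
    by apply: contra_not nKz; exact: suppK.
  by rewrite -leNgt => mu0; exists U => _; split=> //; apply/eqP; rewrite -measure_le0.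
have [U UP] := choice nbhs0.
rewrite compact_cover in cC.
have [D DC CU] : finite_subset_cover C U C.
  apply: cC; first by move=> z /CK /UP[].
  by move=> z Cz; exists z => //; have [] := UP z (CK z Cz).
have mU (z : T) : z \in D -> measurable (U z : set (borel T)) /\ mu (U z) = 0%E.
  by move=> /DC /set_mem /CK /UP [oU _ mu0]; split=> //; exact: measurable_open.
have negC : mu.-negligible (\big[setU/set0]_(z <- D) (U z : set (borel T))).
  rewrite big_seq; elim/big_ind: _ => [||z /mU [mUz mu0]].
  - exact: negligible_set0.
  - exact: negligibleU.
  - by apply/negligibleP.
suff : mu C = 0%E by move=> ->.
apply/negligibleP => //; apply: negligibleS negC => z /CU [y /= Dy Uyz].
by rewrite -bigcup_seq; exists y.
Qed.

End integration.

(** * Inner regular measures are determined by their integrals *)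

Section regular_measures.
Variables (R : realType) (T : ptopologicalType).
Hypotheses (hT : hausdorff_space T) (nT : normal_space T).

Lemma le_measure_compact (mu nu : {finite_measure set (borel T) -> \bar R})
    (C : set T) :
  inner_regular nu ->
  (forall f : T -> R, bounded_continuous f ->
     \int[mu]_x f x = \int[nu]_x f x) ->
  compact C -> (mu C <= nu C)%E.
Proof.
move=> nu_radon munu cC; have mC := measurable_compact hT cC.
have clC := compact_closed hT cC.
apply/lee_addgt0Pr => e e_gt0.
have nufin : nu (~` C) \is a fin_num by rewrite fin_num_measure//; exact: measurableC.
(* Inner regularity on the complement of [C] supplies what amounts to outer regularity at [C]. *)
have [|_ [D [mD cD DC] <-] nuD] := @ereal_sup_gt _ [set nu C' | C' in
    [set C' : set (borel T) |
     [/\ measurable C', compact (C' : set T) & C' `<=` ~` C]]] (nu (~` C) - e%:E)%E.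
  rewrite -(nu_radon _ (measurableC mC)) lteBlDr// lteDl//.
(* f separates C from a compact D filling the complement of C up to nu-mass e,
   hence mu C <= int f dmu = int f dnu <= nu (~` D) <= nu C + e. *)
pose f := Urysohn D C : T -> R.
have sepDC : uniform_separator D C.
  move/(@normal_separatorP R) : nT; apply=> //; first exact: compact_closed.
  exact/disjoints_subset.
have fD x : D x -> f x = 0.
  by move=> Dx; apply: (Urysohn_sub0 sepDC); exists x.
have fC x : C x -> f x = 1.
  by move=> Cx; apply: (Urysohn_sub1 sepDC); exists x.
have f01 x : 0 <= f x <= 1.
  by have := @Urysohn_range _ R D C (f x); rewrite /= in_itv/=; apply; exists x.
have fbc : bounded_continuous f.
  split; first exact: Urysohn_continuous.
  by exists 1 => x; have /andP[f0 f1] := f01 x; rewrite ger0_norm.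
have RintE (l : {finite_measure set (borel T) -> \bar R}) :
    (\int[l]_x (f x)%:E)%E = (\int[l]_x f x)%:E.
  rewrite fineK//; apply: integrable_fin_num => //.
  exact: bounded_continuous_integrable.
have indicT (l : {finite_measure set (borel T) -> \bar R}) (A : set (borel T)) :
    measurable A -> l A = (\int[l]_x (\1_A x)%:E)%E.
  by move=> mA; rewrite integral_indic// setIT.
have fmeas : measurable_fun setT (EFin \o (f : borel T -> R)).
  by apply/measurable_EFinP; apply: continuous_measurable; case: fbc.
apply: (@le_trans _ _ (\int[mu]_x (f x)%:E)%E).
  rewrite indicT//.
  apply: ge0_le_integral => //=.
  - by apply/measurable_EFinP; exact: measurable_indic.
  - move=> x _; rewrite lee_fin indicE; have [/set_mem /fC ->//|_] := boolP (x \in C).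
    by case/andP: (f01 x).
rewrite RintE munu// -RintE.
apply: (@le_trans _ _ (nu (~` D))).
  rewrite [leRHS]indicT//; last exact: measurableC.
  apply: ge0_le_integral => //=.
  - by move=> x _; rewrite lee_fin; case/andP: (f01 x).
  - by apply/measurable_EFinP; apply: measurable_indic; exact: measurableC.
  - move=> x _; rewrite lee_fin indicE in_setC.
    have [/set_mem /fD ->//|_] := boolP (x \in D).
    by case/andP: (f01 x).
(* The second piece is the part of the complement of [C] missed by [D], of [nu]-mass at most [e]. *)
have -> : ~` D = C `|` (~` C `\` D).
  rewrite setDE setUIr setUv setTI; apply/esym/setUidr => x Cx Dx.
  exact: DC Dx Cx.
have mCD : measurable ((~` C `\` D) : set (borel T)).
  by apply: measurableD => //; exact: measurableC.
apply: (le_trans (measureU2 nu mC mCD)); apply: leeD2l.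
rewrite measureD//; last 2 first.
  exact: measurableC.
  by rewrite ltey_eq nufin.
rewrite (setIidr DC) leeBlDr ?fin_num_measure// addeC -leeBlDr//; exact: ltW.
Qed.

(** Inner regularity reduces equality to compact sets, where [le_measure_compact] applies with the
    two measures in either role. *)
Lemma inner_regular_measure_eq (mu nu : {finite_measure set (borel T) -> \bar R}) :
  inner_regular mu -> inner_regular nu ->
  (forall f : T -> R, bounded_continuous f ->
     \int[mu]_x f x = \int[nu]_x f x) ->
  forall A : set (borel T), measurable A -> mu A = nu A.
Proof.
move=> mu_radon nu_radon munu A mA; rewrite mu_radon// nu_radon//.
apply/eqP; rewrite eq_le; apply/andP; split; apply: ge_ereal_sup.
- move=> _ [C [mC cC CA] <-]; apply: (@le_trans _ _ (nu C)).
    exact: le_measure_compact.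
  by apply: ereal_sup_ubound; exists C.
- move=> _ [C [mC cC CA] <-]; apply: (@le_trans _ _ (mu C)).
    by apply: le_measure_compact => // f /munu.
  by apply: ereal_sup_ubound; exists C.
Qed.

End regular_measures.

(** * Kernels and partitions of unity *)

(** [rho] stands for the squared kernel distance. The tents [e - rho z x], cut off at 0, are divided
    by their sum over finitely many centres; the factor [chi] makes the supports compact. *)
Lemma partition_of_unity (R : realType) (T : ptopologicalType)
    (rho : T -> T -> R) (K : set T) (chi : T -> R) (e : R) :
  hausdorff_space T ->
  (forall z, continuous (rho z)) -> (forall z, rho z z = 0) ->
  compact K -> Cc chi -> (forall x, 0 <= chi x) ->
  (forall x, K x -> chi x = 1) -> 0 < e ->
  exists (s : seq T) (phi : T -> T -> R),
    [/\ forall z, Cc (phi z), forall z x, 0 <= phi z x,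
        forall z x, phi z x != 0 -> rho z x < e &
        forall x, K x -> \sum_(z <- s) phi z x = 1].
Proof.
move=> hT rhoc rho0 cK [chic chiS] chi_ge0 chiK e_gt0.
(* Covering at half the scale makes some tent at least [e / 2] at each point of [K], which is the
   lower bound built into [m]. *)
pose V z := [set x | rho z x < e / 2].
have [D _ KV] : finite_subset_cover [set: T] V K.
  rewrite compact_cover in cK; apply: cK => [z _|z Kz].
    apply: (@open_comp _ _ (rho z) [set r | r < e / 2]); last exact: open_lt.
    by move=> x _; exact: rhoc.
  by exists z => //; rewrite /V/= rho0 divr_gt0.
pose psi z x := Num.max 0 (e - rho z x).
have psic z : continuous (psi z).
  apply: (@max_fun_continuous _ _ R (cst 0) (fun x => e - rho z x)).
    by move=> x; exact: cvg_cst.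
  by move=> x; apply: cvgB; [exact: cvg_cst | exact: rhoc].
have psi_ge0 z x : 0 <= psi z x by rewrite /psi le_max lexx.
pose S x := \sum_(z <- enum_fset D) psi z x.
have Sc : continuous S by apply: continuous_sum => z _.
(* The lower bound keeps the denominator positive off K; on K it is inactive. *)
pose m x := Num.max (e / 2) (S x).
have m_gt0 x : 0 < m x by rewrite /m lt_max divr_gt0.
have mc : continuous m.
  apply: (@max_fun_continuous _ _ R (cst (e / 2)) S) => //.
  by move=> x; exact: cvg_cst.
exists (enum_fset D), (fun z x => chi x * (psi z x / m x)); split.
- move=> z; apply: (Cc_vanishing_outside hT chiS) => x.
    apply: cvgM; first exact: chic.
    apply: cvgM; first exact: psic.
    by apply: cvgV; [rewrite gt_eqF | exact: mc].
  by rewrite mulf_eq0 negb_or => /andP[chi0 _]; exact: subset_closure.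
- by move=> z x; rewrite mulr_ge0// divr_ge0// ltW.
- move=> z x; rewrite !mulf_eq0 !negb_or => /and3P[_ psi0 _].
  have := psi_ge0 z x; rewrite le_eqVlt eq_sym (negPf psi0)/=.
  by rewrite /psi lt_max ltxx subr_gt0.
- move=> x Kx; under eq_bigr do rewrite chiK// mul1r.
  rewrite -mulr_suml -/(S x).
  have S_ge : e / 2 <= S x.
    have [z Dz Vzx] := KV x Kx.
    rewrite /S (bigD1_seq z)//= ?fset_uniq//.
    apply: (@le_trans _ _ (psi z x)).
      by rewrite /psi le_max; apply/orP; right; move: Vzx; rewrite /V/=; lra.
    by rewrite lerDl; apply: sumr_ge0 => y _; exact: psi_ge0.
  suff -> : m x = S x.
    by rewrite divff// gt_eqF// (lt_le_trans _ S_ge)// divr_gt0.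
  by apply/max_idPr.
Qed.

(** * Hilbert space geometry of the reproducing kernel *)

Section reproducing_kernel.
Variables (R : realType) (T : Type) (W : set (T -> R)).
Variables (ip : (T -> R) -> (T -> R) -> R) (k : T -> T -> R).
Hypothesis hW : is_rkhs W ip k.
Let hH := rkhs_hilbert hW.

Lemma fhs_ip_linear_r (a : R) (f g h : T -> R) : W f -> W g -> W h ->
  ip h (a *: f + g) = a * ip h f + ip h g.
Proof.
move=> Wf Wg Wh; have Wfg := fhs_linear hH a Wf Wg.
by rewrite (fhs_ipC hH)// (fhs_ip_linear hH)// !(fhs_ipC hH Wh).
Qed.

Lemma fhs_ip0 (f : T -> R) : W f -> ip f (cst 0) = 0.
Proof.
move=> Wf; have W0 := fhs_zero hH; have := fhs_ip_linear_r (-1) W0 W0 Wf.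
have -> : -1 *: cst 0 + cst 0 = cst 0 :> (T -> R) by rewrite scaler0 add0r.
by rewrite mulN1r addNr.
Qed.

Lemma fhs_scale (a : R) (f : T -> R) : W f -> W (a *: f).
Proof. by move=> Wf; have := fhs_linear hH a Wf (fhs_zero hH); rewrite addr0. Qed.

Lemma hnorm0 : hnorm ip (cst 0) = 0.
Proof. by rewrite /hnorm (fhs_ip0 (fhs_zero hH)) sqrtr0. Qed.

Lemma hnormZ (a : R) (f : T -> R) : W f -> hnorm ip (a *: f) = `|a| * hnorm ip f.
Proof.
move=> Wf; have W0 := fhs_zero hH.
have ipZ g : W g -> ip g (a *: f) = a * ip g f.
  move=> Wg; have := fhs_ip_linear_r a Wf W0 Wg.
  have -> : a *: f + cst 0 = a *: f by rewrite addr0.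
  by rewrite (fhs_ip0 Wg) addr0.
rewrite /hnorm ipZ; last exact: fhs_scale.
rewrite (fhs_ipC hH _ Wf); last exact: fhs_scale.
by rewrite ipZ// mulrA -expr2 sqrtrM ?sqr_ge0// sqrtr_sqr.
Qed.

Lemma fhs_cauchy_schwarz (f g : T -> R) : W f -> W g ->
  ip f g ^+ 2 <= ip f f * ip g g.
Proof.
move=> Wf Wg; have Wgf a := fhs_linear hH a Wg Wf.
have expand a : 0 <= a ^+ 2 * ip g g + a * ip f g *+ 2 + ip f f.
  have := fhs_ip_ge0 hH (Wgf a).
  rewrite (fhs_ip_linear hH)// !fhs_ip_linear_r// (fhs_ipC hH Wg Wf).
  by congr (0 <= _); ring.
have gg := fhs_ip_ge0 hH Wg.
move: gg; rewrite le_eqVlt => /orP[/eqP gg0|gg_gt0].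
  have -> : g = cst 0 by apply: (fhs_ip_eq0 hH).
  by rewrite (fhs_ip0 Wf) expr0n mulr_ge0 ?(fhs_ip_ge0 hH)//; exact: fhs_zero hH.
(* This value of [a] minimises the quadratic in [expand]. *)
have := expand (- ip f g / ip g g).
rewrite [leRHS](_ : _ = ip f f - ip f g ^+ 2 / ip g g); last first.
  by field; rewrite gt_eqF.
by rewrite subr_ge0 ler_pdivrMr.
Qed.

(** The factor in parentheses is the squared norm of [k x - k z], whose inner product with [w] is
    [w x - w z]. *)
Lemma rkhs_dist (w : T -> R) (x z : T) : W w ->
  (w x - w z) ^+ 2 <= ip w w * (k z z + k x x - k z x *+ 2).
Proof.
move=> Ww; have Wk := rkhs_kernel hW; have rep := rkhs_reproducing hW.
have Wd := fhs_linear hH (-1) (Wk z) (Wk x).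
have -> : w x - w z = ip w (-1 *: k z + k x).
  by rewrite fhs_ip_linear_r// !rep// mulN1r addrC.
apply: le_trans (fhs_cauchy_schwarz Ww Wd) _.
rewrite fhs_ip_linear_r// !(fhs_ip_linear hH)//.
rewrite !rep// (_ : k x z = k z x); last by rewrite -!rep// (fhs_ipC hH).
by rewrite le_eqVlt; apply/orP; left; apply/eqP; ring.
Qed.

End reproducing_kernel.

(** * The dual distance on varifolds *)

Section varifold_distance.
Variables (R : realType) (n d : nat) (hd : (d <= n)%N).
Local Notation X := (vspc R hd).
Let hX : hausdorff_space X := @hausdorff_vspc R n d hd.

(** Since the Grassmannian factor is compact, a cutoff in the position variable alone has compact
    support. *)
Lemma vspc_cutoff (K : set X) : compact K ->
  exists chi : X -> R,
    [/\ Cc chi, forall z, 0 <= chi z & forall z, K z -> chi z = 1].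
Proof.
move=> cK.
have fstc : continuous (fst : X -> 'rV[R]_n) by move=> z; exact: cvg_fst.
have : compact ((fst : X -> 'rV[R]_n) @` K).
  by apply: continuous_compact => //; exact: continuous_subspaceT.
move=> /compact_bounded [c [_ normK]].
pose r := c + 1.
have Kr z : K z -> `|z.1| <= r.
  by move=> Kz; apply: normK; [rewrite /r; lra | exists z].
(* Equal to 1 up to radius [r], to 0 from radius [r + 1] on, and affine in the norm in between. *)
pose chi (z : X) := Num.min 1 (Num.max 0 (r + 1 - `|z.1|)).
have chic : continuous chi.
  apply: (@min_fun_continuous _ _ R (cst 1) (cst 0 \max (fun z : X => r + 1 - `|z.1|))).
    by move=> z; exact: cvg_cst.
  apply: max_fun_continuous; first by move=> z; exact: cvg_cst.
  move=> z; apply: cvgB; first exact: cvg_cst.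
  by apply: cvg_norm; exact: fstc.
exists chi; split.
- pose B := [set x : 'rV[R]_n | `|x| <= r + 1].
  have cB : compact B.
    apply: bounded_closed_compact.
      exists (r + 1); split; first exact: num_real.
      by move=> b rb x /= Bx; apply: le_trans Bx (ltW rb).
    apply: (@closed_comp _ _ (fun x : 'rV[R]_n => `|x|) [set t | t <= r + 1]).
      by move=> x _; exact: norm_continuous.
    exact: closed_le.
  apply: (@Cc_vanishing_outside _ _ hX (B `*` setT)) => //.
    by apply: compact_setX => //; exact: compact_ograss.
  move=> z chi0; split=> //; rewrite /B/= leNgt; apply: contra chi0 => zr.
  by rewrite /chi (max_idPl _) ?(min_idPr _)// subr_le0 ltW.
- by move=> z; rewrite /chi le_min ler01 le_max lexx.
- by move=> z /Kr zr; rewrite /chi (min_idPl _)// le_max; apply/orP; right; lra.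
Qed.

Variables (M : R) (K : set X).
Hypotheses (M_gt0 : 0 < M) (cK : compact K).
Local Notation V := (varifold R hd).
Local Notation D := (@varifolds_in R n d hd M K).
Implicit Types mu nu : V.

Lemma varifolds_in_mass mu : D mu -> (mu setT <= M%:E)%E.
Proof. by case; rewrite /weight setXTT. Qed.

Lemma varifolds_in_null mu : D mu -> mu (~` K) = 0%E.
Proof.
case=> _ suppK; apply: (measure0_outside_support (vmeas_radon mu)).
  exact: compact_closed.
by move=> z /suppK.
Qed.

Lemma pairing_le mu (f : X -> R) (c : R) : D mu -> bounded_continuous f ->
  0 <= c -> (forall z, K z -> `|f z| <= c) -> `|pairing mu f| <= c * M.
Proof.
move=> Dmu bf c_ge0 fle.
exact: (le_Rintegral_concentrated hX cK (varifolds_in_null Dmu)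
  (varifolds_in_mass Dmu)).
Qed.

Lemma pairingB mu (f g : X -> R) :
  bounded_continuous f -> bounded_continuous g ->
  pairing mu (fun z => f z - g z) = pairing mu f - pairing mu g.
Proof.
by move=> bf bg; apply: RintegralB => //; exact: bounded_continuous_integrable.
Qed.

Lemma pairingZ mu (a : R) (f : X -> R) : bounded_continuous f ->
  pairing mu (fun z => a * f z) = a * pairing mu f.
Proof. by move=> bf; apply: RintegralZl => //; exact: bounded_continuous_integrable. Qed.

Variables (W : set (X -> R)) (ip : (X -> R) -> (X -> R) -> R).
Variable k : X -> X -> R.
Hypotheses (hW : is_rkhs W ip k) (hemb : embeds_in_C0 W ip).
Let hH := rkhs_hilbert hW.
Local Notation dist := (dWstar W ip).

Lemma rkhs_bounded_continuous w : W w -> bounded_continuous w.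
Proof. by move=> /hemb.1; exact: C0_bounded_continuous. Qed.

(** The zero function lies in the unit ball, so the supremum is not the one of the empty set, which
    would be minus infinity. *)
Lemma dWstar_ge0 mu nu : (0 <= dist mu nu)%E.
Proof.
apply: (@le_trans _ _ (`|pairing mu (cst 0) - pairing nu (cst 0)|)%:E).
  by rewrite lee_fin.
apply: ereal_sup_ubound; exists (cst 0) => //=.
by split; [exact: fhs_zero hH | rewrite (hnorm0 hW)].
Qed.

Lemma pairing_unit_ball : exists2 c : R, 0 <= c & forall w, W w ->
  hnorm ip w <= 1 -> forall z, `|w z| <= c.
Proof.
(* The embedding constant comes without a sign, hence the absolute value. *)
have [_ [c wle]] := hemb; exists `|c| => // w Ww w1 z.
apply: (le_trans (wle w Ww z)); apply: (@le_trans _ _ (`|c| * hnorm ip w)).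
  by rewrite ler_wpM2r ?sqrtr_ge0 ?ler_norm.
by rewrite ler_piMr.
Qed.

Lemma dWstar_fin_num mu nu : D mu -> D nu -> dist mu nu \is a fin_num.
Proof.
move=> Dmu Dnu; have [c c_ge0 wc] := pairing_unit_ball.
rewrite ge0_fin_numE ?dWstar_ge0//.
apply: (@le_lt_trans _ _ (c * M + c * M)%:E); last exact: ltry.
apply: ge_ereal_sup => _ [w [Ww w1] <-]; rewrite lee_fin.
apply: (le_trans (ler_normB _ _)); apply: lerD; apply: pairing_le => //;
  [exact: rkhs_bounded_continuous | | exact: rkhs_bounded_continuous |] => z _;
  exact: wc.
Qed.

(** Dividing [w] by [hnorm ip w + 1] brings it into the unit ball; the added 1 avoids a separate
    case for norm zero. *)
Lemma pairing_le_dWstar mu nu (w : X -> R) (r : R) :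
  (dist mu nu <= r%:E)%E -> W w ->
  `|pairing mu w - pairing nu w| <= r * (hnorm ip w + 1).
Proof.
move=> dr Ww; have bw := rkhs_bounded_continuous Ww.
have h_ge0 : 0 <= hnorm ip w by exact: sqrtr_ge0.
pose a := (hnorm ip w + 1)^-1.
have a_gt0 : 0 < a by rewrite invr_gt0; lra.
have : ((`|pairing mu (a *: w) - pairing nu (a *: w)|)%:E <= r%:E)%E.
  apply: le_trans dr; apply: ereal_sup_ubound; exists (a *: w) => //.
  split; first exact: fhs_scale hW _ _ Ww.
  by rewrite (hnormZ hW)// gtr0_norm// mulrC ler_pdivrMr; lra.
rewrite lee_fin !(pairingZ _ a bw) -mulrBr normrM gtr0_norm// mulrC.
by rewrite ler_pdivrMr//; lra.
Qed.

Lemma dWstar_sym mu nu : dist mu nu = dist nu mu.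
Proof.
congr ereal_sup; apply/seteqP; split=> _ [w Ww <-]; exists w => //;
  by rewrite distrC.
Qed.

Lemma dWstar_triangle mu nu xi : (dist mu xi <= dist mu nu + dist nu xi)%E.
Proof.
apply: ge_ereal_sup => _ [w Ww <-].
apply: (@le_trans _ _ ((`|pairing mu w - pairing nu w|)%:E +
                       (`|pairing nu w - pairing xi w|)%:E)%E).
  by rewrite -EFinD lee_fin ler_distD.
by apply: leeD; apply: ereal_sup_ubound; exists w.
Qed.

(** On [K] the difference between [w] and the sum of the [w z * phi z] is the sum of the
    [(w x - w z) * phi z x]. This is an average of quantities of size at most [e]. *)
Lemma pairing_partition_le mu (s : seq X) (phi : X -> X -> R) (w : X -> R)
    (e : R) :
  D mu -> W w -> 0 <= e -> (forall z, Cc (phi z)) ->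
  (forall z x, 0 <= phi z x) ->
  (forall x, K x -> \sum_(z <- s) phi z x = 1) ->
  (forall z x, phi z x != 0 -> `|w x - w z| <= e) ->
  `|pairing mu w - \sum_(z <- s) w z * pairing mu (phi z)| <= e * M.
Proof.
move=> Dmu Ww e_ge0 phic phi_ge0 phi1 phiw.
have bphi z : bounded_continuous (phi z) by exact/C0_bounded_continuous/Cc_C0.
have bwphi z : bounded_continuous (fun x => w z * phi z x).
  exact: bounded_continuousZ.
under eq_bigr do rewrite -pairingZ//.
rewrite /pairing -Rintegral_sum// -[X in `|X|]pairingB; last 2 first.
- exact: rkhs_bounded_continuous.
- exact: bounded_continuous_sum.
apply: pairing_le => //.
  apply: bounded_continuousB; first exact: rkhs_bounded_continuous.
  exact: bounded_continuous_sum.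
move=> x Kx; rewrite -[X in `|X - _|]mul1r -(phi1 x Kx) mulr_suml -sumrB.
apply: (le_trans (ler_norm_sum _ _ _)).
rewrite -[leRHS]mul1r -(phi1 x Kx) mulr_suml; apply: ler_sum => z _.
rewrite (mulrC (w z)) -mulrBr normrM ger0_norm//.
have [->|/phiw wxz] := eqVneq (phi z x) 0; first by rewrite !mul0r.
by rewrite ler_wpM2l.
Qed.

Lemma weak_star_dWstar_cvg (I : Type) (F : set_system I) (mu_ : I -> V) mu :
  ProperFilter F -> (forall z, continuous (k z)) ->
  continuous (fun z => k z z) ->
  (forall i, D (mu_ i)) -> D mu -> weak_star_cvg F mu_ mu ->
  dist (mu_ i) mu @[i --> F] --> 0%E.
Proof.
move=> FF kc kdiagc Dmu_ Dmu cvgmu.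
apply/fine_cvgP; split; first by apply: nearW => i; exact: dWstar_fin_num.
apply/cvgr0Pnorm_le => e e_gt0.
have [c c_ge0 wc] := pairing_unit_ball.
(* The partition costs [e / 4] for each of the two varifolds, which leaves [e / 2] for the finite
   sum. *)
pose e' := e / (4 * M).
have e'_gt0 : 0 < e' by rewrite divr_gt0// mulr_gt0.
have e'M : e' * M = e / 4 by rewrite /e'; field; rewrite gt_eqF.
pose rho z x := k z z + k x x - k z x *+ 2.
have rhoc z : continuous (rho z).
  move=> x; apply: cvgB; last by apply: cvgMn; exact: kc.
  by apply: cvgD; [exact: cvg_cst | exact: kdiagc].
have rho0 z : rho z z = 0 by rewrite /rho mulr2n subrr.
have [chi [chic chi_ge0 chiK]] := vspc_cutoff cK.
(* The scale is squared because [rho] is a squared distance. *)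
have e'2_gt0 : 0 < e' ^+ 2 by rewrite exprn_gt0.
have [s [phi [phic phi_ge0 phirho phi1]]] :=
  partition_of_unity hX rhoc rho0 cK chic chi_ge0 chiK e'2_gt0.
have phiw w z x : W w -> hnorm ip w <= 1 -> phi z x != 0 -> `|w x - w z| <= e'.
  move=> Ww w1 /phirho rhozx.
  have ww_ge0 := fhs_ip_ge0 hH Ww.
  have ww_le1 : ip w w <= 1.
    by rewrite -(sqr_sqrtr ww_ge0) -/(hnorm ip w) expr_le1// sqrtr_ge0.
  rewrite -(@ler_pXn2r _ 2) ?nnegrE ?(ltW e'_gt0)// real_normK ?num_real//.
  apply: (le_trans (rkhs_dist hW x z Ww)); rewrite -/(rho z x).
  (* For negative [rho] the product with [ip w w] is nonpositive, so the bound holds without knowing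
     the sign of [rho]. *)
  have [rho_ge0|rho_lt0] := leP 0 (rho z x).
    by apply: le_trans (ltW rhozx); rewrite ler_piMl.
  by apply: (@le_trans _ _ 0); [rewrite mulr_ge0_le0// ltW | exact: ltW].
(* Replacing [w z] by its bound [c] makes [u] independent of [w], so its convergence to 0 is uniform
   over the unit ball. *)
pose u i := \sum_(z <- s) c * `|pairing (mu_ i) (phi z) - pairing mu (phi z)|.
have u0 : u i @[i --> F] --> 0.
  have -> : 0 = \sum_(z <- s) (c * `|pairing mu (phi z) - pairing mu (phi z)|) :> R.
    by rewrite big1// => z _; rewrite subrr normr0 mulr0.
  apply: cvg_big => [x|z _].
    by apply: cvgD; [exact: cvg_fst | exact: cvg_snd].
  apply: cvgMl_tmp; apply: cvg_norm; apply: cvgB; last exact: cvg_cst.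
  exact: cvgmu.
have : \forall i \near F, `|u i| <= e / 2.
  by move/cvgr0Pnorm_le : u0; apply; rewrite divr_gt0.
apply: filterS => i; rewrite ger0_norm; last first.
  by apply: sumr_ge0 => z _; rewrite mulr_ge0.
move=> ui; rewrite ger0_norm ?fine_ge0 ?dWstar_ge0// -lee_fin fineK ?dWstar_fin_num//.
apply: ge_ereal_sup => _ [w [Ww w1] <-]; rewrite lee_fin.
have approx nu : D nu ->
    `|pairing nu w - \sum_(z <- s) w z * pairing nu (phi z)| <= e / 4.
  move=> Dnu; rewrite -e'M; apply: pairing_partition_le => //; first exact: ltW.
  by move=> z x; exact: phiw.
have sumle : `|\sum_(z <- s) w z * pairing (mu_ i) (phi z) -
               \sum_(z <- s) w z * pairing mu (phi z)| <= e / 2.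
  apply: le_trans ui; rewrite -sumrB; apply: (le_trans (ler_norm_sum _ _ _)).
  by apply: ler_sum => z _; rewrite -mulrBr normrM ler_wpM2r// wc.
have := approx _ (Dmu_ i); have := approx _ Dmu; move: sumle.
rewrite !ler_norml => /andP[? ?] /andP[? ?] /andP[? ?].
by apply/andP; split; lra.
Qed.

Hypothesis huniv : C0_universal W.

Lemma pairing_C0_approx (f : X -> R) (e : R) : C0 f -> 0 < e ->
  exists2 w, W w & forall mu, D mu -> `|pairing mu f - pairing mu w| <= e * M.
Proof.
move=> f0 e_gt0; have [w Ww wf] := huniv.2 f f0 e e_gt0.
have bf := C0_bounded_continuous f0; have bw := rkhs_bounded_continuous Ww.
exists w => // mu Dmu; rewrite -pairingB//; apply: pairing_le => //.
- exact: bounded_continuousB.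
- exact: ltW.
- by move=> z _; rewrite distrC.
Qed.

Lemma dWstar_weak_star_cvg (I : Type) (F : set_system I) (mu_ : I -> V) mu :
  ProperFilter F -> (forall i, D (mu_ i)) -> D mu ->
  dist (mu_ i) mu @[i --> F] --> 0%E -> weak_star_cvg F mu_ mu.
Proof.
move=> FF Dmu_ Dmu /fine_cvgP[_ dist0] f fc.
apply/cvgrPdist_le => e e_gt0.
have e'_gt0 : 0 < e / (4 * M) by rewrite divr_gt0// mulr_gt0.
have e'M : e / (4 * M) * M = e / 4 by field; rewrite gt_eqF.
have [w Ww wf] := pairing_C0_approx (Cc_C0 fc) e'_gt0.
rewrite e'M in wf.
have h_gt0 : 0 < hnorm ip w + 1 by rewrite ltr_wpDl// sqrtr_ge0.
(* [pairing_le_dWstar] multiplies this radius by [hnorm ip w + 1], giving [e / 2]; the two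
   approximations of [f] by [w] account for the remaining [e / 4] each. *)
have : \forall i \near F, `|fine (dist (mu_ i) mu)| <= e / 2 / (hnorm ip w + 1).
  by move/cvgr0Pnorm_le : dist0; apply; rewrite !divr_gt0.
apply: filterS => i disti.
have distw : (dist (mu_ i) mu <= (e / 2 / (hnorm ip w + 1))%:E)%E.
  rewrite -[leLHS]fineK ?dWstar_fin_num// lee_fin.
  exact: le_trans (ler_norm _) disti.
have := pairing_le_dWstar distw Ww; rewrite divfK ?gt_eqF//.
have := wf _ Dmu; have := wf _ (Dmu_ i).
rewrite !ler_norml => /andP[? ?] /andP[? ?] /andP[? ?].
by apply/andP; split; lra.
Qed.

(** At distance zero the pairings agree on [W], then on [C0] by density, then on bounded continuous
    functions by localisation near [K]; inner regularity concludes. *)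
Lemma dWstar_eq0 mu nu : D mu -> D nu -> (dist mu nu = 0%E <-> vequal mu nu).
Proof.
move=> Dmu Dnu; split=> [dist0|munu]; last first.
  have pE w : pairing mu w = pairing nu w.
    by congr fine; apply: eq_measure_integral => A mA _; exact: munu.
  apply/eqP; rewrite eq_le dWstar_ge0 andbT.
  by apply: ge_ereal_sup => _ [w _ <-]; rewrite pE subrr normr0.
have pC0 f : C0 f -> pairing mu f = pairing nu f.
  move=> f0; apply/eqP; rewrite -subr_eq0 -normr_le0.
  apply/ler_addgt0Pr => e e_gt0; rewrite add0r.
  have e'_gt0 : 0 < e / (2 * M) by rewrite divr_gt0// mulr_gt0.
  have e'M : e / (2 * M) * M = e / 2 by field; rewrite gt_eqF.
  have [w Ww wf] := pairing_C0_approx f0 e'_gt0.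
  rewrite e'M in wf.
  have dist_le0 : (dist mu nu <= 0%:E)%E by rewrite dist0.
  have := pairing_le_dWstar dist_le0 Ww.
  have := wf _ Dmu; have := wf _ Dnu; rewrite mul0r.
  rewrite !ler_norml => /andP[? ?] /andP[? ?] /andP[? ?].
  by apply/andP; split; lra.
apply: (inner_regular_measure_eq hX (@pseudometric_normal R X)).
- exact: vmeas_radon.
- exact: vmeas_radon.
move=> f bf; have [chi [chic chi_ge0 chiK]] := vspc_cutoff cK.
have fchi0 : C0 (fun z => chi z * f z).
  apply/Cc_C0/(Cc_vanishing_outside hX chic.2).
    by move=> z; apply: cvgM; [exact: chic.1 | exact: bf.1].
  by move=> z; rewrite mulf_eq0 negb_or => /andP[? _]; exact: subset_closure.
(* The cutoff is 1 on [K], which carries all the mass, so it leaves the pairing unchanged. *)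
have localize xi : D xi -> pairing xi f = pairing xi (fun z => chi z * f z).
  move=> Dxi; apply/eqP; rewrite -subr_eq0 -normr_le0 -pairingB//; last first.
    exact: C0_bounded_continuous.
  rewrite -(mul0r M); apply: pairing_le => //.
    by apply: bounded_continuousB => //; exact: C0_bounded_continuous.
  by move=> z Kz; rewrite chiK// mul1r subrr normr0.
rewrite -[LHS]/(pairing mu f) -[RHS]/(pairing nu f).
by rewrite (localize _ Dmu) (localize _ Dnu) pC0.
Qed.

End varifold_distance.

Unset Implicit Arguments.

Theorem corollary3p11 (R : realType) (n d : nat) (hd : (d <= n)%N)
  (kpos : 'rV[R]_n -> 'rV[R]_n -> R)
  (kG : ograss R hd -> ograss R hd -> R)
  (hkpos_cont : continuous (fun p : 'rV[R]_n * 'rV[R]_n => kpos p.1 p.2))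
  (hkpos_pd : positive_definite kpos)
  (hkpos_C0 : forall x : 'rV[R]_n, C0 (kpos x))
  (hkG_cont : continuous (fun p : ograss R hd * ograss R hd => kG p.1 p.2))
  (hkG_pd : positive_definite kG)
  (W : set (vspc R hd -> R))
  (ip : (vspc R hd -> R) -> (vspc R hd -> R) -> R)
  (hW : is_rkhs W ip (prod_kernel kpos kG))
  (hW_emb : embeds_in_C0 W ip)
  (M : R) (hM : 0 < M) (K : set (vspc R hd)) (hK : compact K)
  (huniv : C0_universal W) :
  metrizes_weak_star_on (varifolds_in M K) (dWstar W ip).
Proof.
have kc z : continuous (prod_kernel kpos kG z : vspc R hd -> R).
  exact: (huniv.1 _ (rkhs_kernel hW z)).1.
(* Separate continuity would not suffice on the diagonal; the joint continuity of both factors is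
   used here. *)
have kdiagc : continuous (fun z : vspc R hd => prod_kernel kpos kG z z).
  move=> [x t]; apply: cvgM.
    apply: (@continuous2_cvg _ _ _ _ _ _ fst fst kpos x x).
    - exact: hkpos_cont (x, x).
    - exact: cvg_fst.
    - exact: cvg_fst.
  apply: (@continuous2_cvg _ _ _ _ _ _ snd snd kG t t).
  - exact: hkG_cont (t, t).
  - exact: cvg_snd.
  - exact: cvg_snd.
split.
  split=> [mu nu Dmu Dnu|mu nu Dmu Dnu|mu nu _ _|mu nu xi _ _ _].
  - exact: (dWstar_fin_num hK hW hW_emb Dmu Dnu).
  - exact: (dWstar_eq0 hM hK hW hW_emb huniv).
  - exact: dWstar_sym.
  - exact: dWstar_triangle.
move=> I F FF mu_ mu Dmu_ Dmu; split.
- exact: (weak_star_dWstar_cvg hM hK hW hW_emb).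
- exact: (dWstar_weak_star_cvg hM hK hW hW_emb huniv).
Qed.
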